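(* Let $R$ be a ring and let $\{M_i\}_{i\in I}$ be a family of right $R$-modules. Then $\bigoplus_{i\in I}M_i$ is abelian endoregular if and only if, for every $i\in I$, $M_i$ is a fully invariant submodule of $\bigoplus_{j\in I}M_j$ and $M_i$ is an abelian endoregular module.
   Context: Rings are associative with identity and modules are unitary right modules. A ring $S$ is von Neumann regular if for every $s\in S$ there is $x\in S$ with $sxs=s$; it is abelian if every idempotent of $S$ is central. A module $M$ is abelian endoregular if $\operatorname{End}_R(M)$ is an abelian von Neumann regular ring. A submodule $N$ of $M$ is fully invariant if $\varphi(N)\subseteq N$ for all $\varphi\in\operatorname{End}_R(M)$. Each $M_i$ is identified with its canonical image in the direct sum. *)

(* Defs.v *)
From HB Require Import structures.
From mathcomp Require Import all_boot all_algebra all_classical.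

Set Implicit Arguments.
Unset Strict Implicit.
Unset Printing Implicit Defensive.

Import GRing.Theory.
Local Open Scope ring_scope.
Local Open Scope classical_set_scope.

(* A right R-module is a left module over the converse ring: the right action
   x . r is (r : R^c) *: x, and a *: (b *: x) = (a * b) *: x in R^c reads
   (x . b) . a = x . (b a) in R. *)
Notation rmodType R := (lmodType R^c).

(* pzRingType, unlike nzRingType, includes the zero ring, which occurs as the
   endomorphism ring of the zero module. *)
Definition von_neumann_regular (S : pzRingType) : Prop :=
  forall s : S, exists x : S, s * x * s = s.

Definition abelian_ring (S : pzRingType) : Prop :=
  forall e : S, e * e = e -> forall s : S, e * s = s * e.

Definition modEnd (R : pzRingType) (M : rmodType R) : Type := {linear M -> M}.

Definition modEnd_linear (R : pzRingType) (M : rmodType R) (f : modEnd M) :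
  {linear M -> M} := f.

Coercion modEnd_linear : modEnd >-> GRing.Linear.type.

Section EndomorphismRing.
Variables (R : pzRingType) (M : rmodType R).
Implicit Types f g h : modEnd M.

Lemma modEndP f g : f =1 g -> f = g.
Proof.
case: f => f [[f1] [f2]]; case: g => g [[g1] [g2]] /= /funext eq_fg.
case: _ / eq_fg in g1 g2 *.
by rewrite (Prop_irrelevance f1 g1) (Prop_irrelevance f2 g2).
Qed.

HB.instance Definition _ := gen_eqMixin (modEnd M).
HB.instance Definition _ := gen_choiceMixin (modEnd M).

Definition modEnd_zero : modEnd M := \0 : {linear M -> M}.
Definition modEnd_opp f : modEnd M := (\- f) : {linear M -> M}.
Definition modEnd_add f g : modEnd M := (f \+ g) : {linear M -> M}.
Definition modEnd_one : modEnd M := idfun : {linear M -> M}.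
Definition modEnd_mul f g : modEnd M := (f \o g) : {linear M -> M}.

Fact modEnd_addA : associative modEnd_add.
Proof. by move=> f g h; apply: modEndP => x /=; rewrite addrA. Qed.
Fact modEnd_addC : commutative modEnd_add.
Proof. by move=> f g; apply: modEndP => x /=; rewrite addrC. Qed.
Fact modEnd_add0 : left_id modEnd_zero modEnd_add.
Proof. by move=> f; apply: modEndP => x /=; rewrite add0r. Qed.
Fact modEnd_addN : left_inverse modEnd_zero modEnd_opp modEnd_add.
Proof. by move=> f; apply: modEndP => x /=; rewrite addNr. Qed.

HB.instance Definition _ := GRing.isZmodule.Build (modEnd M)
  modEnd_addA modEnd_addC modEnd_add0 modEnd_addN.

Fact modEnd_mulA : associative modEnd_mul.
Proof. by move=> f g h; apply: modEndP. Qed.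
Fact modEnd_mul1 : left_id modEnd_one modEnd_mul.
Proof. by move=> f; apply: modEndP. Qed.
Fact modEnd_mulr1 : right_id modEnd_one modEnd_mul.
Proof. by move=> f; apply: modEndP. Qed.
Fact modEnd_mulDl : left_distributive modEnd_mul modEnd_add.
Proof. by move=> f g h; apply: modEndP. Qed.
Fact modEnd_mulDr : right_distributive modEnd_mul modEnd_add.
Proof. by move=> f g h; apply: modEndP => x /=; rewrite linearD. Qed.

HB.instance Definition _ := GRing.Zmodule_isPzRing.Build (modEnd M)
  modEnd_mulA modEnd_mul1 modEnd_mulr1 modEnd_mulDl modEnd_mulDr.

Lemma modEnd_mulE f g x : (f * g) x = f (g x). Proof. by []. Qed.
Lemma modEnd_oneE x : (1 : modEnd M) x = x. Proof. by []. Qed.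
Lemma modEnd_addE f g x : (f + g) x = f x + g x. Proof. by []. Qed.
Lemma modEnd_zeroE x : (0 : modEnd M) x = 0. Proof. by []. Qed.

End EndomorphismRing.

Definition abelian_endoregular (R : pzRingType) (M : rmodType R) : Prop :=
  abelian_ring (modEnd M) /\ von_neumann_regular (modEnd M).

Definition fully_invariant_submodule (R : pzRingType) (M : rmodType R)
    (N : set M) : Prop :=
  submod_closed [in N] /\ forall phi : modEnd M, phi @` N `<=` N.

Record dirsum (R : pzRingType) (I : Type) (M : I -> rmodType R) : Type :=
  Dirsum {
    dirsum_fun :> forall i, M i;
    dirsum_finite : finite_set [set i | dirsum_fun i != 0]
  }.

Section DirectSum.
Variables (R : pzRingType) (I : Type) (M : I -> rmodType R).
Implicit Types (u v w : dirsum M) (a b : R^c).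

Lemma dirsumP u v : (forall i, u i = v i) -> u = v.
Proof.
case: u => u finu; case: v => v finv /= eq_uv.
have {}eq_uv : u = v by apply: functional_extensionality_dep.
by case: _ / eq_uv in finv *; congr Dirsum; apply: Prop_irrelevance.
Qed.

HB.instance Definition _ := gen_eqMixin (dirsum M).
HB.instance Definition _ := gen_choiceMixin (dirsum M).

Fact dirsum_zero_finite : finite_set [set i | (0 : M i) != 0].
Proof. by rewrite (_ : [set i | _] = set0)// -subset0 => i /=; rewrite eqxx. Qed.
Definition dirsum_zero : dirsum M := Dirsum dirsum_zero_finite.

Fact dirsum_opp_finite u : finite_set [set i | - u i != 0].
Proof.
apply: sub_finite_set (dirsum_finite u) => i /=.
by rewrite oppr_eq0.
Qed.
Definition dirsum_opp u : dirsum M := Dirsum (dirsum_opp_finite u).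

Fact dirsum_add_finite u v : finite_set [set i | u i + v i != 0].
Proof.
have finU : finite_set ([set i | u i != 0] `|` [set i | v i != 0]).
  by rewrite finite_setU; split; apply: dirsum_finite.
apply: sub_finite_set finU => i /=.
have [->|] := eqVneq (u i) 0; last by left.
by rewrite add0r; right.
Qed.
Definition dirsum_add u v : dirsum M := Dirsum (dirsum_add_finite u v).

Fact dirsum_scale_finite a u : finite_set [set i | a *: u i != 0].
Proof.
apply: sub_finite_set (dirsum_finite u) => i /=.
by apply: contraNneq => ->; rewrite scaler0.
Qed.
Definition dirsum_scale a u : dirsum M := Dirsum (dirsum_scale_finite a u).

Fact dirsum_addA : associative dirsum_add.
Proof. by move=> u v w; apply: dirsumP => i /=; rewrite addrA. Qed.
Fact dirsum_addC : commutative dirsum_add.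
Proof. by move=> u v; apply: dirsumP => i /=; rewrite addrC. Qed.
Fact dirsum_add0 : left_id dirsum_zero dirsum_add.
Proof. by move=> u; apply: dirsumP => i /=; rewrite add0r. Qed.
Fact dirsum_addN : left_inverse dirsum_zero dirsum_opp dirsum_add.
Proof. by move=> u; apply: dirsumP => i /=; rewrite addNr. Qed.

HB.instance Definition _ := GRing.isZmodule.Build (dirsum M)
  dirsum_addA dirsum_addC dirsum_add0 dirsum_addN.

Fact dirsum_scaleA a b u :
  dirsum_scale a (dirsum_scale b u) = dirsum_scale (a * b) u.
Proof. by apply: dirsumP => i /=; rewrite scalerA. Qed.
Fact dirsum_scale1 : left_id 1 dirsum_scale.
Proof. by move=> u; apply: dirsumP => i /=; rewrite scale1r. Qed.
Fact dirsum_scaleDr : right_distributive dirsum_scale +%R.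
Proof. by move=> a u v; apply: dirsumP => i /=; rewrite scalerDr. Qed.
Fact dirsum_scaleDl u : {morph dirsum_scale^~ u : a b / a + b}.
Proof. by move=> a b; apply: dirsumP => i /=; rewrite scalerDl. Qed.

HB.instance Definition _ := GRing.Zmodule_isLmodule.Build R^c (dirsum M)
  dirsum_scaleA dirsum_scale1 dirsum_scaleDr dirsum_scaleDl.

Lemma dirsum_addE u v i : (u + v) i = u i + v i. Proof. by []. Qed.
Lemma dirsum_zeroE i : (0 : dirsum M) i = 0. Proof. by []. Qed.
Lemma dirsum_scaleE a u i : (a *: u) i = a *: u i. Proof. by []. Qed.

Definition dirsum_single i (x : M i) (j : I) : M j :=
  match pselect (i = j) with
  | left e => ecast k (M k) e x
  | right _ => 0
  end.

Lemma dirsum_single_eq i (x : M i) : dirsum_single x i = x.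
Proof.
rewrite /dirsum_single; case: pselect => // e.
by rewrite (Prop_irrelevance e erefl).
Qed.

Lemma dirsum_single_neq i (x : M i) j : i <> j -> dirsum_single x j = 0.
Proof. by rewrite /dirsum_single; case: pselect. Qed.

Fact dirsum_single_finite i (x : M i) :
  finite_set [set j | dirsum_single x j != 0].
Proof.
apply: sub_finite_set (finite_set1 i) => j /=.
by case: (pselect (i = j)) => [<-//|/dirsum_single_neq->]; rewrite eqxx.
Qed.

Definition dirsum_inj i (x : M i) : dirsum M := Dirsum (dirsum_single_finite x).

Fact dirsum_inj_is_linear i : linear (@dirsum_inj i).
Proof.
move=> a x y; apply: dirsumP => j; rewrite dirsum_addE dirsum_scaleE /=.
case: (pselect (i = j)) => [<-|ne_ij]; first by rewrite !dirsum_single_eq.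
by rewrite !dirsum_single_neq// scaler0 addr0.
Qed.

HB.instance Definition _ i :=
  GRing.isLinear.Build R^c (M i) (dirsum M) *:%R (@dirsum_inj i)
    (@dirsum_inj_is_linear i).

End DirectSum.

(* Main.v *)
Require Import Defs.
From HB Require Import structures.
From mathcomp Require Import all_boot all_algebra all_classical.

(** Let [S] be the endomorphism ring of the direct sum and [e_i] its idempotent
    with image [M i]; then [End (M i)] is the corner ring [e_i S e_i]. If [S] is
    abelian, [e_i] is central, so [M i] is fully invariant; regularity and
    centrality of idempotents pass to corners. Conversely, if all [M i] are
    fully invariant, then every endomorphism of the direct sum acts diagonally,
    so [S] is the product of the rings [End (M i)]. *)

Import GRing.Theory.
Local Open Scope ring_scope.
Local Open Scope classical_set_scope.

Section DirectSumEndomorphisms.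
Variables (R : pzRingType) (I : Type) (M : I -> rmodType R).
Implicit Types (u v : dirsum M) (phi psi : modEnd (dirsum M : rmodType R)).

Local Notation inj i := (@dirsum_inj R I M i).

Definition dirsum_proj i u : M i := u i.
Arguments dirsum_proj : simpl never.

Fact dirsum_proj_is_linear i : linear (dirsum_proj i).
Proof. by []. Qed.

HB.instance Definition _ i :=
  GRing.isLinear.Build R^c (dirsum M) (M i) *:%R (dirsum_proj i)
    (dirsum_proj_is_linear i).

Lemma dirsum_injK i : cancel (inj i) (dirsum_proj i).
Proof. by move=> x; apply: dirsum_single_eq. Qed.

Lemma dirsum_subE u v i : (u - v) i = u i - v i.
Proof. by []. Qed.

(** Induction on the size of the support, which is finite: a nonzero component is peeled off at each
    step. *)
Lemma dirsum_ind (P : dirsum M -> Prop) :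
  P 0 -> (forall i (x : M i) u, P u -> P (inj i x + u)) -> forall u, P u.
Proof.
move=> P0 PD u; have [n] := dirsum_finite u.
elim: n u => [|n IHn] u.
  rewrite II0 card_eq0 => /eqP supp0; suff -> : u = 0 by [].
  apply: dirsumP => i; rewrite dirsum_zeroE; apply/eqP/negPn/negP => ui.
  by have : set0 i by rewrite -supp0.
move=> /eq_cardSP[i /= ui supp_n].
(* Subtracting the component at [i] removes exactly [i] from the support. *)
rewrite -[u](subrKC (inj i (u i))); apply: (PD); apply: IHn.
rewrite (_ : [set j | _] = [set j | u j != 0] `\ i)//.
apply/seteqP; split => j; rewrite /mkset dirsum_subE /=.
  case: (pselect (i = j)) => [<-|ne_ij].
    by rewrite dirsum_single_eq subrr eqxx.
  by rewrite dirsum_single_neq// subr0; split => // /esym.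
by move=> [uj ne_ji]; rewrite dirsum_single_neq ?subr0// => /esym.
Qed.

(** Extension by zero on the other summands; [corner_ext i 1] is the idempotent [e_i]. *)
Definition corner_ext i (f : modEnd (M i)) : modEnd (dirsum M : rmodType R) :=
  (inj i \o f \o dirsum_proj i) : {linear dirsum M -> dirsum M}.

Definition corner i phi : modEnd (M i) :=
  (dirsum_proj i \o phi \o inj i) : {linear M i -> M i}.

Lemma corner_extM i (f g : modEnd (M i)) :
  corner_ext i (f * g) = corner_ext i f * corner_ext i g.
Proof. by apply: modEndP => u; rewrite modEnd_mulE /= dirsum_injK. Qed.

Lemma corner_extK i : cancel (corner_ext i) (corner i).
Proof. by move=> f; apply: modEndP => x; rewrite /= !dirsum_injK. Qed.

(** Compression to a corner need not be multiplicative, but it respects products whose outer factors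
    already lie in the corner. This is what carries a quasi-inverse down to [M i]. *)
Lemma corner_mul_ext i (f g : modEnd (M i)) phi :
  corner i (corner_ext i f * phi * corner_ext i g) = f * corner i phi * g.
Proof. by apply: modEndP => x; rewrite /= !dirsum_injK. Qed.

Lemma corner_abelian_endoregular i :
  abelian_endoregular (dirsum M : rmodType R) -> abelian_endoregular (M i).
Proof.
move=> [abM regM]; split=> [e ee s|s].
  (* Commutation is tested after the injective multiplicative map [corner_ext i], which sends
     idempotents to idempotents. *)
  apply: (can_inj (corner_extK i)); rewrite !corner_extM; apply: abM.
  by rewrite -corner_extM ee.
have [phi sphis] := regM (corner_ext i s); exists (corner i phi).
by rewrite -corner_mul_ext sphis corner_extK.
Qed.

Lemma range_dirsum_inj_submod_closed i : submod_closed [in range (inj i)].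
Proof.
split; first by rewrite inE; exists 0 => //; rewrite linear0.
move=> a u v; rewrite !inE => -[x _ <-] [y _ <-].
by exists (a *: x + y) => //; rewrite linearP.
Qed.

Lemma abelian_fully_invariant i :
  abelian_ring (modEnd (dirsum M : rmodType R)) ->
  fully_invariant_submodule (range (inj i)).
Proof.
move=> abM; split; first exact: range_dirsum_inj_submod_closed.
move=> phi _ [_ [x _ <-] <-].
have /abM /(_ phi) e_phi : corner_ext i 1 * corner_ext i 1 = corner_ext i 1.
  by rewrite -corner_extM mulr1.
(* As [e_i] fixes [inj i x] and commutes with [phi], it also fixes [phi (inj i x)], which therefore
   equals the image of its own component at [i]. *)
exists (phi (inj i x) i) => //.
transitivity ((corner_ext i 1 * phi) (inj i x)); first by [].
by rewrite e_phi modEnd_mulE /= dirsum_injK.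
Qed.

Fact dirsum_diag_finite (f : forall i, modEnd (M i)) u :
  finite_set [set i | f i (u i) != 0].
Proof.
apply: sub_finite_set (dirsum_finite u) => i /=.
by apply: contraNneq => ->; rewrite linear0.
Qed.

Definition dirsum_diag_fun (f : forall i, modEnd (M i)) u : dirsum M :=
  Dirsum (dirsum_diag_finite f u).

Fact dirsum_diag_is_linear f : linear (dirsum_diag_fun f).
Proof. by move=> a u v; apply: dirsumP => i; apply: linearP. Qed.

HB.instance Definition _ f :=
  GRing.isLinear.Build R^c (dirsum M) (dirsum M) *:%R (dirsum_diag_fun f)
    (dirsum_diag_is_linear f).

Definition dirsum_diag f : modEnd (dirsum M : rmodType R) :=
  dirsum_diag_fun f : {linear dirsum M -> dirsum M}.

Lemma corner_diag f i : corner i (dirsum_diag f) = f i.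
Proof.
apply: modEndP => x; rewrite /= /dirsum_proj /=.
by rewrite dirsum_single_eq.
Qed.

Section FullyInvariant.
Hypothesis fi : forall i, fully_invariant_submodule (range (inj i)).

Lemma fully_invariant_inj phi i (x : M i) :
  phi (inj i x) = inj i (corner i phi x).
Proof.
have [_ /(_ phi (phi (inj i x))) []] := fi i; first by exists (inj i x).
by move=> y _ phix; rewrite /= -phix dirsum_injK.
Qed.

(** By additivity it suffices to take [u] in a single summand, which [phi] maps into itself. *)
Lemma fully_invariant_diag phi u i : (phi u) i = corner i phi (u i).
Proof.
elim/dirsum_ind: u => [|j x u IHu]; first by rewrite !linear0.
rewrite linearD !dirsum_addE [RHS]linearD IHu; congr (_ + _).
rewrite fully_invariant_inj /=.
case: (pselect (j = i)) => [<-|ne_ji]; first by rewrite !dirsum_single_eq.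
by rewrite !dirsum_single_neq// !linear0.
Qed.

(** Holds because the component at [i] of [phi v] depends only on that of [v]. *)
Lemma cornerM i phi psi : corner i (phi * psi) = corner i phi * corner i psi.
Proof. by apply: modEndP => x; rewrite modEnd_mulE -fully_invariant_diag. Qed.

Lemma corner_inj phi psi : (forall i, corner i phi = corner i psi) -> phi = psi.
Proof.
move=> eq_c; apply: modEndP => u; apply: dirsumP => i.
by rewrite !fully_invariant_diag eq_c.
Qed.

Lemma dirsum_abelian_endoregular :
  (forall i, abelian_endoregular (M i)) ->
  abelian_endoregular (dirsum M : rmodType R).
Proof.
move=> aeM; split=> [e ee s|s].
  apply: corner_inj => i; rewrite !cornerM; apply: (aeM i).1.
  by rewrite -cornerM ee.
(* A quasi-inverse is chosen in every corner; the diagonal map they form is one for [s]. *)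
pose x i := sval (cid ((aeM i).2 (corner i s))).
exists (dirsum_diag x); apply: corner_inj => i.
by rewrite !cornerM corner_diag /x; case: cid.
Qed.

End FullyInvariant.

End DirectSumEndomorphisms.

Theorem proposition2p17 (R : pzRingType) (I : Type) (M : I -> rmodType R) :
  abelian_endoregular (dirsum M : rmodType R) <->
  (forall i : I,
     fully_invariant_submodule (range (@dirsum_inj R I M i)) /\
     abelian_endoregular (M i)).
Proof.
split=> [aeM i|fi_ae].
  split; last exact: corner_abelian_endoregular.
  exact: abelian_fully_invariant aeM.1.
by apply: dirsum_abelian_endoregular => i; have [] := fi_ae i.
Qed.
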